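(* Let $I=[0,1]$ and $F=F_{\{1/2,3\}}=\{(x,3x):x\in[0,\tfrac13]\}\cup\{(x,\tfrac x2):x\in[0,1]\}\subseteq I^2$. Then the dynamical system $(I_F^+,\sigma_F^+)$ does not have the shadowing property.
   Context: $I_F^+=\{(x_1,x_2,\ldots)\in I^{\mathbb N}: (x_i,x_{i+1})\in F\ \forall i\ge 1\}$, with metric $D(\mathbf x,\mathbf y)=\sup_{i\ge1}|x_i-y_i|/2^i$, and $\sigma_F^+(x_1,x_2,\ldots)=(x_2,x_3,\ldots)$. Let $(Y,f)$ be a dynamical system ($Y$ compact metric with metric $d$, $f:Y\to Y$ continuous). For $\delta>0$, a sequence $(x_0,x_1,\ldots)$ in $Y$ is a $\delta$-pseudo-orbit if $d(f(x_n),x_{n+1})<\delta$ for every $n\ge0$. $(Y,f)$ has the shadowing property if for each $\varepsilon>0$ there is $\delta>0$ such that for each $\delta$-pseudo-orbit $(x_k)_{k\ge 0}$ there is $y\in Y$ with $d(f^k(y),x_k)<\varepsilon$ for all $k\ge 0$. *)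

(* Defs.v *)
From HB Require Import structures.
From mathcomp Require Import all_boot all_order all_algebra.
From mathcomp Require Import all_classical all_reals all_analysis.
From mathcomp Require Import ring lra.

Set Implicit Arguments.
Unset Strict Implicit.
Unset Printing Implicit Defensive.

Import Order.TTheory GRing.Theory Num.Theory.
Import numFieldTopology.Exports numFieldNormedType.Exports.

Local Open Scope classical_set_scope.
Local Open Scope ring_scope.

Record dynSystem (R : realType) := DynSystem {
  phase :> metricType R;
  evol : phase -> phase;
  phase_compact : compact [set: phase];
  evol_continuous : continuous evol
}.

Arguments evol {R} d _.

Definition pseudo_orbit (R : realType) (Y : dynSystem R) (delta : R)
    (x : nat -> Y) : Prop :=
  forall n, mdist (evol Y (x n)) (x n.+1) < delta.

Definition has_shadowing (R : realType) (Y : dynSystem R) : Prop :=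
  forall eps : R, 0 < eps ->
  exists2 delta : R, 0 < delta &
    forall x : nat -> Y, pseudo_orbit delta x ->
    exists y : Y, forall k, mdist (iter k (evol Y) y) (x k) < eps.

(* The points of I_F^+.  Sequences are indexed from 0 here, so that
   [mval x i] is the coordinate x_(i+1) of a sequence (x_1, x_2, ...). *)
Record mahavier (R : realType) (F : set (R * R)) := Mahavier {
  mval :> nat -> R;
  mval_itv : forall i, `[0, 1]%classic (mval i);
  mval_rel : forall i, F (mval i, mval i.+1)
}.

Section Mahavier.
Context {R : realType} {F : set (R * R)}.
Implicit Types x y z : mahavier F.

Lemma mahavier_ext x y : (forall i, x i = y i) -> x = y.
Proof.
case: x y => [x x1 x2] [y y1 y2] /= /funext xy; subst y.
by congr Mahavier; exact: Prop_irrelevance.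
Qed.

HB.instance Definition _ := gen_eqMixin (mahavier F).
HB.instance Definition _ := gen_choiceMixin (mahavier F).

(* The weight is 2 ^ (i + 1) because of the indexing from 0. *)
Definition mahavier_dist x y : R :=
  sup [set `|x i - y i| / 2 ^+ i.+1 | i in [set: nat]].

Lemma mahavier_term_le x y i : `|x i - y i| / 2 ^+ i.+1 <= 2^-1 ^+ i.+1.
Proof.
have := mval_itv x i; have := mval_itv y i; rewrite /= !in_itv /=.
move=> /andP[y0 y1] /andP[x0 x1].
by rewrite exprVn ler_piMl// ler_norml; apply/andP; split; lra.
Qed.

Lemma mahavier_dist_has_sup x y :
  has_sup [set `|x i - y i| / 2 ^+ i.+1 | i in [set: nat]].
Proof.
split; first by exists (`|x 0%N - y 0%N| / 2 ^+ 1), 0%N.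
exists 1 => _ [i _ <-]; apply: (le_trans (mahavier_term_le x y i)).
by apply: exprn_ile1; lra.
Qed.

Lemma mahavier_dist_ge x y i : `|x i - y i| / 2 ^+ i.+1 <= mahavier_dist x y.
Proof. by apply: ub_le_sup; [case: (mahavier_dist_has_sup x y)|exists i]. Qed.

Lemma mahavier_dist_le x y (M : R) :
  (forall i, `|x i - y i| / 2 ^+ i.+1 <= M) -> mahavier_dist x y <= M.
Proof.
move=> xyM; apply: ge_sup; first by case: (mahavier_dist_has_sup x y).
by move=> _ [i _ <-].
Qed.

Lemma mahavier_dist_ge0 x y : 0 <= mahavier_dist x y.
Proof. by apply: le_trans (mahavier_dist_ge x y 0); rewrite divr_ge0. Qed.

Lemma mahavier_distxx x : mahavier_dist x x = 0.
Proof.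
apply/eqP; rewrite eq_le mahavier_dist_ge0 andbT.
by apply: mahavier_dist_le => i; rewrite subrr normr0 mul0r.
Qed.

Lemma mahavier_dist_eq0 x y : mahavier_dist x y = 0 -> x = y.
Proof.
move=> xy0; apply: mahavier_ext => i; have := mahavier_dist_ge x y i.
rewrite xy0 ler_pdivrMr ?exprn_gt0// mul0r normr_le0 subr_eq0.
by move/eqP.
Qed.

Lemma mahavier_dist_sym x y : mahavier_dist x y = mahavier_dist y x.
Proof. by congr sup; apply: eq_imagel => i _; rewrite distrC. Qed.

Lemma mahavier_dist_triangle y x z :
  mahavier_dist x z <= mahavier_dist x y + mahavier_dist y z.
Proof.
apply: mahavier_dist_le => i.
apply: le_trans (lerD (mahavier_dist_ge x y i) (mahavier_dist_ge y z i)).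
by rewrite -mulrDl ler_pM2r ?invr_gt0 ?exprn_gt0// ler_distD.
Qed.

HB.instance Definition _ := isMetric.Build R (mahavier F)
  mahavier_distxx mahavier_dist_eq0 mahavier_dist_sym mahavier_dist_triangle.

Lemma mahavier_mdistE x y :
  mdist x y = sup [set `|x i - y i| / 2 ^+ i.+1 | i in [set: nat]].
Proof. by []. Qed.

Definition mahavier_shift x : mahavier F :=
  @Mahavier R F (fun i => x i.+1)
    (fun i => mval_itv x i.+1) (fun i => mval_rel x i.+1).

Lemma mahavier_shift_lipschitz x y :
  mdist (mahavier_shift x) (mahavier_shift y) <= 2 * mdist x y.
Proof.
apply: mahavier_dist_le => i /=.
rewrite -ler_pdivrMl// mulrC -mulrA -invfM -exprSr.
exact: mahavier_dist_ge.
Qed.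

Lemma mahavier_shift_continuous : continuous mahavier_shift.
Proof.
move=> x B /nbhs_ballP[e /= e0 eB]; apply/nbhs_ballP.
exists (e / 2) => /=; first by rewrite divr_gt0.
move=> y; rewrite ballEmdist /= => xy; apply: eB; rewrite ballEmdist /=.
apply: le_lt_trans (mahavier_shift_lipschitz x y) _.
by rewrite -ltr_pdivlMl// mulrC.
Qed.

Let rawset : set {ptws nat -> R} :=
  [set u | (forall i, `[0, 1]%classic (u i)) /\
           (forall i, F (u i, u i.+1))].

Let rawset_compact : closed F -> compact rawset.
Proof.
move=> cF.
pose K : set {ptws nat -> R} := [set u | forall i, `[0, 1]%classic (u i)].
have cK : compact K.
  exact: (@tychonoff nat (fun=> R) (fun=> `[0, 1]%classic)
            (fun=> @segment_compact R 0 1)).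
pose E : set {ptws nat -> R} :=
  \bigcap_(i in [set: nat]) [set u | F (u i, u i.+1)].
have cE : closed E.
  apply: closed_bigI => i _.
  have pc j : continuous (fun u : {ptws nat -> R} => u j).
    exact: (@proj_continuous nat (fun=> R) j).
  have c : continuous (fun u : {ptws nat -> R} => (u i, u i.+1)).
    by move=> u; exact: (cvg_pair (pc i u) (pc i.+1 u)).
  exact: (closed_comp (fun u _ => c u) cF).
have -> : rawset = K `&` E.
  by apply/seteqP; split=> u [u1 u2]; split=> // i; [move=> _|]; exact: u2.
exact: compact_closedI.
Qed.

Lemma mahavier_compact : closed F -> compact [set: mahavier F].
Proof.
move=> /rawset_compact cP G PG _.
pose f : mahavier F -> {ptws nat -> R} := @mval R F.
have fP : (f @ G) rawset.
  apply: (@filterE _ G _ (f @^-1` rawset)) => x; exact: conj (mval_itv x) (mval_rel x).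
have [p [[p1 p2] clp]] := cP (f @ G) _ fP.
pose q := Mahavier p1 p2; exists q; split=> // A B GA /nbhs_ballP[e /= e0 qeB].
have e20 : 0 < e / 2 by rewrite divr_gt0.
have [N Ne] : exists N, 2^-1 ^+ N <= e / 2 :> R.
  have : (fun n => 2^-1 ^+ n : R) @ \oo --> (0 : R).
    by apply: cvg_expr; rewrite ger0_norm; lra.
  move=> /cvgrPdist_lt /(_ _ e20) [N _ /(_ N (leqnn N))] /=.
  by rewrite sub0r normrN ger0_norm ?exprn_ge0// => /ltW ?; exists N.
have pN : nbhs (p : {ptws nat -> R})
    [set u : {ptws nat -> R} | forall i : 'I_N, `|p i - u i| < e / 2].
  apply: (@filter_forall _ _ (fun i : 'I_N =>
    [set u : {ptws nat -> R} | `|p i - u i| < e / 2]) _ (nbhs_filter _)) => i.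
  exact: (@proj_continuous nat (fun=> R) i p _ (nbhsx_ballx (p i : R) _ e20)).
have fA : (f @ G) (f @` A).
  by apply: (@filterS _ G _ A (f @^-1` (f @` A))) GA => x Ax; exists x.
have [_ [[x Ax <-] /= px]] := clp _ _ fA pN.
exists x; split=> //; apply: qeB; rewrite ballEmdist /=.
apply: (@le_lt_trans _ _ (e / 2)); last lra.
apply: mahavier_dist_le => i; case: (ltnP i N) => iN.
  rewrite ler_pdivrMr ?exprn_gt0//.
  apply: (le_trans (ltW (px (Ordinal iN)))).
  by rewrite ler_peMr ?(ltW e20)// exprn_ege1//; lra.
apply: (le_trans (mahavier_term_le q x i)); apply: le_trans Ne.
by apply: ler_wiXn2l; [lra|lra|exact: leqW].
Qed.

End Mahavier.

Definition mahavier_system (R : realType) (F : set (R * R)) (cF : closed F) :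
    dynSystem R :=
  DynSystem (mahavier_compact cF) (@mahavier_shift_continuous R F).

Arguments mahavier_system {R} F cF.

Definition F_half_three (R : realType) : set (R * R) :=
  [set (x, 3 * x) | x in `[0, 3^-1]] `|` [set (x, x / 2) | x in `[0, 1]].

Arguments F_half_three : clear implicits.

Lemma closed_F_half_three (R : realType) : closed (F_half_three R).
Proof.
have cl (k a b : R) : closed [set (x, k * x) | x in `[a, b]].
  apply: compact_closed; first exact: norm_hausdorff.
  apply: continuous_compact; last exact: segment_compact.
  apply: continuous_subspaceT => x.
  have c1 : id y @[y --> x] --> x by exact: cvg_id.
  exact: (cvg_pair c1 (@mulrl_continuous R k x)).
apply: closedU; first exact: cl.
rewrite (_ : [set _ | _ in _] = [set (x, 2^-1 * x) | x in `[0, 1]])//.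
by apply: eq_imagel => x _; rewrite mulrC.
Qed.

Arguments closed_F_half_three : clear implicits.

(* Main.v *)
(* Tripling the points of [0, 1/3] and halving the others keeps an orbit in
   [1/6, 1].  By compactness, the itinerary X of the point 1 under this rule has
   two shifts that are delta-close, and closing up the stretch between them gives
   a periodic pseudo-orbit.  Since its coordinates stay away from 0, an orbit y
   that shadows it must make the same choices between tripling and halving, so
   one period multiplies y by 3^a / 2^b with a + b > 0.  This factor is not 1,
   and its powers take y out of [1/12, 1]. *)
Require Import Defs.
From mathcomp Require Import all_boot all_order all_algebra.
From mathcomp Require Import all_classical all_reals all_analysis.
From mathcomp Require Import lra zify.

Set Implicit Arguments.
Unset Strict Implicit.
Unset Printing Implicit Defensive.

Import Order.TTheory GRing.Theory Num.Theory.
Import numFieldTopology.Exports numFieldNormedType.Exports.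

Local Open Scope classical_set_scope.
Local Open Scope ring_scope.

(** The sequence clusters at some [p], so each of its tails meets the ball of radius [delta / 2]
    around [p]; the second term is taken from the tail after the first. *)
Lemma compact_seq_recurrent (R : realType) (T : metricType R) (u : nat -> T) :
  compact [set: T] -> forall delta : R, 0 < delta ->
  exists i j, (i < j)%N /\ mdist (u j) (u i) < delta.
Proof.
move=> cT delta d0.
have uT : (u @ \oo) [set: T] by exact: filterT.
have [p [_ clp]] := cT (u @ \oo) _ uT.
have d20 : 0 < delta / 2 by rewrite divr_gt0.
have pd : nbhs p (ball p (delta / 2)) by exact: nbhsx_ballx.
have tail m : (u @ \oo) (u @` [set n | (m <= n)%N]).
  by exists m => // n mn; exists n.
have [_ [[i _ <-] pi]] := clp _ _ (tail 0%N) pd.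
have [_ [[j ij <-] pj]] := clp _ _ (tail i.+1) pd.
exists i, j; split=> //.
move: pi pj; rewrite !ballEmdist /= => pi pj.
have := metric_triangle (u j) p (u i); rewrite (metric_sym (u j) p).
by move=> /le_lt_trans; apply; lra.
Qed.

Lemma exprn_lt1_small (R : realType) (x e : R) :
  0 <= x < 1 -> 0 < e -> exists n, x ^+ n < e.
Proof.
move=> /andP[x0 x1] e0.
have : (fun n => x ^+ n) @ \oo --> (0 : R) by apply: cvg_expr; rewrite ger0_norm.
move=> /cvgrPdist_lt /(_ _ e0) [n _ /(_ n (leqnn n))] /=.
by rewrite sub0r normrN ger0_norm ?exprn_ge0// => ?; exists n.
Qed.

(** Powers of 3 are odd, so equality forces [b = 0], and then [3 ^+ a = 1] forces [a = 0]. *)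
Lemma expr3_neq_expr2 (R : numDomainType) (a b : nat) :
  (0 < a + b)%N -> (3 : R) ^+ a != 2 ^+ b.
Proof.
move=> ab; rewrite -!natrX eqr_nat; apply: contraTneq ab => e.
have := congr1 odd e; rewrite !oddX /= orbT => /esym.
rewrite orbF => /eqP b0; move: e; rewrite b0 => /eqP.
by rewrite expn0 -[X in _ == X](expn0 3) eqn_exp2l// => /eqP ->.
Qed.

Definition mult (R : realType) (c : bool) : R := if c then 3 else 2^-1.
Arguments mult {R}.

(** With [a] triplings and [b] halvings among the [p] factors, the value 1 would mean
    [3 ^+ a = 2 ^+ b]. *)
Lemma prod_mult_neq1 (R : realType) (c : nat -> bool) p : (0 < p)%N ->
  \prod_(k < p) mult (c k) != 1 :> R.
Proof.
move=> p0.
have [a [b [abp ->]]] :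
    exists a b, (a + b)%N = p /\ \prod_(k < p) mult (c k) = 3 ^+ a / 2 ^+ b :> R.
  elim: p {p0} => [|p [a [b [<- IH]]]].
    by exists 0%N, 0%N; rewrite big_ord0 !expr0 divr1.
  rewrite big_ord_recr /= IH /mult; case: (c _).
    by exists a.+1, b; split; [lia | rewrite exprS; lra].
  by exists a, b.+1; split; [lia | rewrite exprS invfM; lra].
rewrite -(inj_eq (mulIf (_ : 2 ^+ b != 0))) ?expf_neq0// divfK ?expf_neq0//.
by rewrite mul1r expr3_neq_expr2// abp.
Qed.

Section Greedy.
Context {R : realType}.

Definition greedy (x : R) : R := mult (x <= 3^-1) * x.

Definition greedy_orbit n : R := iter n greedy 1.

(** Tripling sends [1/6, 1/3] into [1/2, 1], and halving sends (1/3, 1] into (1/6, 1/2]. *)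
Lemma greedy_orbit_bound n : 6^-1 <= greedy_orbit n <= 1.
Proof.
elim: n => [|n]; first by rewrite /=; lra.
rewrite [greedy_orbit n.+1]/= /greedy/mult -/(greedy_orbit n).
by case: ifP; lra.
Qed.

Lemma greedy_orbit_itv n : `[0, 1]%classic (greedy_orbit n).
Proof.
by rewrite /= in_itv /=; have := greedy_orbit_bound n; lra.
Qed.

Lemma greedy_orbit_rel n : F_half_three R (greedy_orbit n, greedy_orbit n.+1).
Proof.
have := greedy_orbit_bound n.
rewrite [greedy_orbit n.+1]/= /greedy/mult -/(greedy_orbit n).
case: ifP => h b; [left|right]; exists (greedy_orbit n) => //=.
- by rewrite in_itv /=; lra.
- by rewrite in_itv /=; lra.
- by rewrite mulrC.
Qed.

Definition greedy_point (i : nat) : mahavier (F_half_three R) :=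
  @Mahavier R _ (fun n => greedy_orbit (i + n))
    (fun n => greedy_orbit_itv (i + n))
    (fun n => eq_ind_r (fun m => F_half_three R (_, greedy_orbit m))
                (greedy_orbit_rel (i + n)) (addnS i n)).

Lemma shift_greedy_point i :
  mahavier_shift (greedy_point i) = greedy_point i.+1.
Proof. by apply: mahavier_ext => n /=; rewrite addnS. Qed.

End Greedy.

Lemma F_half_threeP (R : realType) (x z : R) :
  F_half_three R (x, z) -> z = 3 * x \/ z = x / 2.
Proof. by case=> -[t _ [<- <-]]; [left|right]. Qed.

Lemma iter_shiftE (R : realType) (F : set (R * R)) k (y : mahavier F) n :
  iter k (@mahavier_shift R F) y n = y (k + n)%N.
Proof. by elim: k n => // k IH n; rewrite iterS [LHS]IH addSnnS. Qed.

(* Comparing y with the first two coordinates of the greedy itinerary keeps the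
   jumps of the pseudo-orbit out of the estimate. *)
Lemma shadow_step (R : realType) (y z : mahavier (F_half_three R)) :
  mdist y z < 24^-1 -> 6^-1 <= z 0%N -> z 1%N = greedy (z 0%N) ->
  12^-1 <= y 0%N /\ y 1%N = mult (z 0%N <= 3^-1) * y 0%N.
Proof.
move=> yz z0 z1.
have /le_lt_trans/(_ yz) := mahavier_dist_ge y z 0.
have /le_lt_trans/(_ yz) := mahavier_dist_ge y z 1.
(* The weights 1/2 and 1/4 turn the tolerance 1/24 into errors below 1/12 and 1/6 in the first two
   coordinates, whereas opposite choices would make the second coordinates differ by more than
   3/8. *)
rewrite z1 /greedy /mult !ltr_pdivrMr ?exprn_gt0// !exprS expr0.
rewrite !ltr_norml => h1 h0.
have := F_half_threeP (mval_rel y 0).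
by case: ifP h1 => _ h1 [] E; rewrite E in h1 *; split; lra.
Qed.

Theorem theorem5p3 (R : realType) :
  ~ has_shadowing (mahavier_system (F_half_three R) (closed_F_half_three R)).
Proof.
move=> /(_ 24^-1) [|delta d0 shadow]; first by lra.
have [i [j [ij dij]]] :=
  compact_seq_recurrent (@greedy_point R) (mahavier_compact (closed_F_half_three R)) d0.
pose p := (j - i)%N; have p0 : (0 < p)%N by rewrite subn_gt0.
pose s k := (i + k %% p)%N.
have [|y yP] := shadow (fun k => greedy_point (s k)).
  move=> k; rewrite /= shift_greedy_point /s -addnS.
  (* Within a period the shift is exact; the only jump, from [greedy_point j] back to
     [greedy_point i], is below [delta] by [dij]. *)
  have [kp|kp] := ltnP (k %% p).+1 p.
    rewrite (_ : k.+1 %% p = (k %% p).+1)%N ?mdistxx//.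
    by rewrite -addn1 -modnDml addn1 modn_small.
  have {}kp : (k %% p).+1 = p by apply/eqP; rewrite eqn_leq kp ltn_pmod.
  rewrite kp -[k.+1]addn1 -modnDml addn1 kp modnn addn0.
  by rewrite /p subnKC// ltnW.
pose c k := greedy_orbit (s k) <= 3^-1 :> R.
have step k : 12^-1 <= y k /\ y k.+1 = mult (c k) * y k.
  have := @shadow_step R _ _ (yP k).
  rewrite /= !addn0 addn1 => /(_ _ erefl).
  rewrite !iter_shiftE addn0 addn1; apply.
  by case/andP: (greedy_orbit_bound (R := R) (s k)).
have yprod n m : y (n * p + m)%N = \prod_(k < m) mult (c (n * p + k)%N) * y (n * p)%N.
  elim: m => [|m IH]; first by rewrite addn0 big_ord0 mul1r.
  by rewrite addnS (step _).2 IH big_ord_recr /=; lra.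
pose M : R := \prod_(k < p) mult (c k).
have yM n : y (n * p)%N = M ^+ n * y 0%N.
  elim: n => [|n IH]; first by rewrite mul0n mul1r.
  rewrite mulSn addnC yprod IH exprS mulrA; congr (_ * _ * _).
  (* [c] has period [p], so every block of [p] steps contributes the same factor [M]. *)
  by apply: eq_bigr => k _; rewrite /c /s modnMDl.
have yle n : y n <= 1.
  by have := mval_itv y n; rewrite /= in_itv /= => /andP[].
have M0 : 0 < M by apply: prodr_gt0 => k _; rewrite /mult; case: ifP; lra.
(* If [M < 1], then [y (n * p) <= M ^+ n] drops below 1/12; if [M > 1], then [y 0 <= M^-1 ^+ n]
   does. Both contradict [step]. *)
have := prod_mult_neq1 R c p0; rewrite -/M neq_lt => /orP[M1|M1].
  have [n] := @exprn_lt1_small R M 12^-1 ltac:(lra) ltac:(lra).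
  have := (step (n * p)%N).1; have := yle 0%N; have := exprn_ge0 n (ltW M0).
  by rewrite yM; nra.
have [|n] := @exprn_lt1_small R M^-1 12^-1 _ ltac:(lra).
  by rewrite invr_ge0 (ltW M0) invf_lt1.
have := yle (n * p)%N; have := (step 0%N).1.
by rewrite yM -ler_pdivlMl ?exprn_gt0// mulr1 exprVn; lra.
Qed.
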